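(* Let $f:[a,b]\to\mathbb{R}$ be $(l,L)$-Lipschitzian on $[a,b]$. Let $I_n=\{a=x_0<x_1<\cdots<x_n=b\}$ be a given subdivision of $[a,b]$, let $h_i=x_{i+1}-x_i$ and $S_i=\frac{f(x_{i+1})-f(x_i)}{h_i}$ for $i=0,1,\dots,n-1$, and let $\xi=(\xi_0,\dots,\xi_{n-1})$ with $x_i\le\xi_i\le x_{i+1}$ for $i=0,1,\dots,n-1$. (1) We have $\int_a^b f(t)\,dt=A_{Ll}(I_n,\xi,f)+R_{Ll}(I_n,\xi,f)$, where $$A_{Ll}(I_n,\xi,f)=\frac12\sum_{i=0}^{n-1}f(\xi_i)h_i+\frac12\sum_{i=0}^{n-1}\frac{f(x_i)+f(x_{i+1})}{2}h_i-\frac{L+l}{4}\sum_{i=0}^{n-1}\left(\xi_i-\frac{x_i+x_{i+1}}{2}\right)h_i,$$ and the remainder term satisfies $$|R_{Ll}(I_n,\xi,f)|\le\sum_{i=0}^{n-1}\frac12\left[\frac{h_i^2}{8}+\left(\xi_i-\frac{x_i+x_{i+1}}{2}\right)^2\right](L-l).$$ (2) We have $\int_a^b f(t)\,dt=A_{l}(I_n,\xi,f)+R_{l}(I_n,\xi,f)$, where $$A_{l}(I_n,\xi,f)=\frac12\sum_{i=0}^{n-1}f(\xi_i)h_i+\frac12\sum_{i=0}^{n-1}\frac{f(x_i)+f(x_{i+1})}{2}h_i-\frac{l}{2}\sum_{i=0}^{n-1}\left(\xi_i-\frac{x_i+x_{i+1}}{2}\right)h_i,$$ and $$|R_{l}(I_n,\xi,f)|\le\sum_{i=0}^{n-1}h_i\left[\frac{h_i}{4}+\left|\xi_i-\frac{x_i+x_{i+1}}{2}\right|\right](S_i-l).$$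 (3) We have $\int_a^b f(t)\,dt=A_{L}(I_n,\xi,f)+R_{L}(I_n,\xi,f)$, where $$A_{L}(I_n,\xi,f)=\frac12\sum_{i=0}^{n-1}f(\xi_i)h_i+\frac12\sum_{i=0}^{n-1}\frac{f(x_i)+f(x_{i+1})}{2}h_i-\frac{L}{2}\sum_{i=0}^{n-1}\left(\xi_i-\frac{x_i+x_{i+1}}{2}\right)h_i,$$ and $$|R_{L}(I_n,\xi,f)|\le\sum_{i=0}^{n-1}h_i\left[\frac{h_i}{4}+\left|\xi_i-\frac{x_i+x_{i+1}}{2}\right|\right](L-S_i).$$
   Context: Here $a<b$ are real numbers. A function $f:[a,b]\to\mathbb{R}$ is said to be $(l,L)$-Lipschitzian on $[a,b]$, where $l,L\in\mathbb{R}$ with $l<L$, if $l(x_2-x_1)\le f(x_2)-f(x_1)\le L(x_2-x_1)$ for all $a\le x_1\le x_2\le b$. Each remainder term $R_{Ll}$, $R_l$, $R_L$ is defined as the difference between $\int_a^b f(t)\,dt$ and the corresponding quadrature sum $A_{Ll}$, $A_l$, $A_L$. *)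

(* Defs.v *)
From Stdlib Require Export Reals.
From Coquelicot Require Export Coquelicot.
Open Scope R_scope.

(* Functions on [a,b] are total functions R -> R; only their values on [a,b]
   are constrained or used. *)
Definition lipschitzian (l L a b : R) (f : R -> R) : Prop :=
  forall x1 x2 : R, a <= x1 -> x1 <= x2 -> x2 <= b ->
    l * (x2 - x1) <= f x2 - f x1 <= L * (x2 - x1).

(* A subdivision is carried by a sequence of which only x 0, ..., x n matter. *)
Definition subdivides (a b : R) (n : nat) (x : nat -> R) : Prop :=
  x 0%nat = a /\ x n = b /\ forall i : nat, (i < n)%nat -> x i < x (S i).

(* F 0 + ... + F (n - 1); [sum_f_R0 F m] has m + 1 terms. *)
Definition sum_lt (n : nat) (F : nat -> R) : R :=
  match n with
  | O => 0
  | S m => sum_f_R0 F m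
  end.

Definition step (x : nat -> R) (i : nat) : R := x (S i) - x i.

Definition slope (f : R -> R) (x : nat -> R) (i : nat) : R :=
  (f (x (S i)) - f (x i)) / step x i.

Definition midpoint (x : nat -> R) (i : nat) : R := (x i + x (S i)) / 2.

Definition A_Ll (l L : R) (n : nat) (x xi : nat -> R) (f : R -> R) : R :=
  1 / 2 * sum_lt n (fun i => f (xi i) * step x i)
  + 1 / 2 * sum_lt n (fun i => (f (x i) + f (x (S i))) / 2 * step x i)
  - (L + l) / 4 * sum_lt n (fun i => (xi i - midpoint x i) * step x i).

Definition A_l (l : R) (n : nat) (x xi : nat -> R) (f : R -> R) : R :=
  1 / 2 * sum_lt n (fun i => f (xi i) * step x i)
  + 1 / 2 * sum_lt n (fun i => (f (x i) + f (x (S i))) / 2 * step x i)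
  - l / 2 * sum_lt n (fun i => (xi i - midpoint x i) * step x i).

Definition A_L (L : R) (n : nat) (x xi : nat -> R) (f : R -> R) : R :=
  1 / 2 * sum_lt n (fun i => f (xi i) * step x i)
  + 1 / 2 * sum_lt n (fun i => (f (x i) + f (x (S i))) / 2 * step x i)
  - L / 2 * sum_lt n (fun i => (xi i - midpoint x i) * step x i).

(* [RInt] is total, but a lipschitzian f is continuous on [a,b], so here it is
   the genuine Riemann integral. *)
Definition R_Ll (l L a b : R) (n : nat) (x xi : nat -> R) (f : R -> R) : R :=
  RInt f a b - A_Ll l L n x xi f.

Definition R_l (l a b : R) (n : nat) (x xi : nat -> R) (f : R -> R) : R :=
  RInt f a b - A_l l n x xi f.

Definition R_L (L a b : R) (n : nat) (x xi : nat -> R) (f : R -> R) : R :=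
  RInt f a b - A_L L n x xi f.

(* Main.v *)
Require Import Defs.
From Stdlib Require Import Reals Lra Lia.
From Coquelicot Require Import Coquelicot.
Open Scope R_scope.

(** All three rules are the rule [A_l] with a parameter [c], equal to
    [(L + l) / 2], [l] or [L], and its error is a sum over the subintervals
    [[p,q]]. Each local error is bounded by comparing [f] with affine functions
    of slopes [l] and [L] through [p], [q] and the node. Comparing in this way
    avoids differentiating [f]. The case [c = L] is the case [c = l] for [-f],
    which is [(-L,-l)]-Lipschitzian. *)

(** * Finite sums *)

Lemma sum_lt_S (n : nat) (F : nat -> R) : sum_lt (S n) F = sum_lt n F + F n.
Proof. destruct n; simpl; ring. Qed.

Lemma Rabs_sum_lt_le (n : nat) (F G : nat -> R) :
  (forall i, (i < n)%nat -> Rabs (F i) <= G i) ->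
  Rabs (sum_lt n F) <= sum_lt n G.
Proof.
  induction n as [|n IH]; intros H.
  - simpl; rewrite Rabs_R0; lra.
  - rewrite !sum_lt_S.
    apply Rle_trans with (1 := Rabs_triang _ _).
    apply Rplus_le_compat; [apply IH; intros; apply H; lia | apply H; lia].
Qed.

(** * Lipschitzian functions and their integrability *)

Lemma lipschitzian_restrict (l L a b p q : R) (f : R -> R) :
  lipschitzian l L a b f -> a <= p -> q <= b -> lipschitzian l L p q f.
Proof. intros H Hp Hq x1 x2 H1 H2 H3; apply H; lra. Qed.

Lemma lipschitzian_opp (l L a b : R) (f : R -> R) :
  lipschitzian l L a b f -> lipschitzian (- L) (- l) a b (fun t => - f t).
Proof. intros H x1 x2 H1 H2 H3; specialize (H x1 x2 H1 H2 H3); lra. Qed.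

Lemma lipschitzian_Rabs (l L a b u v : R) (f : R -> R) :
  lipschitzian l L a b f -> a <= u <= b -> a <= v <= b ->
  Rabs (f u - f v) <= (Rabs l + Rabs L) * Rabs (u - v).
Proof.
  intros H Hu Hv.
  assert (Hl := Rle_abs l). assert (Hl' := Rle_abs (- l)).
  assert (HL := Rle_abs L). assert (HL' := Rle_abs (- L)).
  rewrite Rabs_Ropp in Hl', HL'.
  apply Rabs_le.
  destruct (Rle_dec u v) as [Huv|Huv].
  - specialize (H u v); rewrite (Rabs_left1 (u - v)) by lra; nra.
  - specialize (H v u); rewrite (Rabs_right (u - v)) by lra; nra.
Qed.

(* The integrand may be discontinuous at the endpoints as a function on R, so
   it is replaced by its continuous extension that is constant outside [a,b]. *)
Lemma lipschitzian_ex_RInt (l L a b : R) (f : R -> R) :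
  a <= b -> lipschitzian l L a b f -> ex_RInt f a b.
Proof.
  intros Hab H.
  set (clamp := fun t => Rmax a (Rmin b t)).
  apply ex_RInt_ext with (f := fun t => f (clamp t)).
  - intros t; rewrite Rmin_left, Rmax_right by lra; intros Ht.
    unfold clamp; rewrite (Rmin_right b t), Rmax_right by lra; reflexivity.
  - apply (ex_RInt_continuous (V := R_CompleteNormedModule)); intros z _.
    assert (Hclamp : forall t, a <= clamp t <= b).
    { intros t; unfold clamp, Rmax, Rmin;
        destruct (Rle_dec b t); destruct (Rle_dec a _); lra. }
    assert (Hdist : forall t, Rabs (clamp t - clamp z) <= Rabs (t - z)).
    { intros t; unfold clamp, Rmax, Rmin, Rabs;
        destruct (Rle_dec b t); destruct (Rle_dec b z);
        repeat destruct (Rle_dec a _); repeat destruct (Rcase_abs _); lra. }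
    set (K := Rabs l + Rabs L).
    assert (HK : 0 <= K)
      by (apply Rplus_le_le_0_compat; apply Rabs_pos).
    apply continuity_pt_filterlim; intros eps Heps.
    (* The [+ 1] keeps the denominator positive when [K = 0]. *)
    exists (eps / (K + 1)); split.
    + apply Rdiv_lt_0_compat; lra.
    + intros t [_ Ht]; simpl in *; unfold Rdist in *.
      apply Rle_lt_trans with (K * Rabs (clamp t - clamp z)).
      { apply lipschitzian_Rabs with a b; auto. }
      assert (H1 := Hdist t). assert (H0 := Rabs_pos (t - z)).
      apply (Rmult_lt_compat_r (K + 1)) in Ht; [|lra].
      replace (eps / (K + 1) * (K + 1)) with eps in Ht by (field; lra).
      nra.
Qed.

(** * Integrals compared with those of affine functions *)

Lemma is_RInt_affine (A B c p q : R) :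
  is_RInt (fun t => A + B * (t - c)) p q
    (A * (q - p) + B * ((q - c) ^ 2 - (p - c) ^ 2) / 2).
Proof.
  replace (A * (q - p) + B * ((q - c) ^ 2 - (p - c) ^ 2) / 2)
    with (minus (A * q + B * (q - c) ^ 2 / 2) (A * p + B * (p - c) ^ 2 / 2))
    by (unfold minus, plus, opp; simpl; field).
  apply (is_RInt_derive (fun t => A * t + B * (t - c) ^ 2 / 2)).
  - intros t _; auto_derive; [exact I | field].
  - intros t _; apply (ex_derive_continuous (V := R_NormedModule)); auto_derive; exact I.
Qed.

Lemma RInt_ge_affine (A B c p q : R) (f : R -> R) :
  p <= q -> ex_RInt f p q ->
  (forall t, p <= t <= q -> A + B * (t - c) <= f t) ->
  A * (q - p) + B * ((q - c) ^ 2 - (p - c) ^ 2) / 2 <= RInt f p q.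
Proof.
  intros Hpq Hf H.
  rewrite <- (is_RInt_unique _ _ _ _ (is_RInt_affine A B c p q)).
  apply RInt_le; auto.
  - eexists; apply is_RInt_affine.
  - intros t Ht; apply H; lra.
Qed.

Lemma RInt_le_affine (A B c p q : R) (f : R -> R) :
  p <= q -> ex_RInt f p q ->
  (forall t, p <= t <= q -> f t <= A + B * (t - c)) ->
  RInt f p q <= A * (q - p) + B * ((q - c) ^ 2 - (p - c) ^ 2) / 2.
Proof.
  intros Hpq Hf H.
  rewrite <- (is_RInt_unique _ _ _ _ (is_RInt_affine A B c p q)).
  apply RInt_le; auto.
  - eexists; apply is_RInt_affine.
  - intros t Ht; apply H; lra.
Qed.

(** The graph of [f] lies between the lines of slopes [l] and [L] through either endpoint. At [q]
    the two slopes exchange roles because [t - q <= 0]. *)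
Lemma lipschitzian_RInt_bounds (l L p q : R) (f : R -> R) :
  p <= q -> lipschitzian l L p q f ->
  (f p * (q - p) + l * (q - p) ^ 2 / 2 <= RInt f p q
     <= f p * (q - p) + L * (q - p) ^ 2 / 2) /\
  (f q * (q - p) - L * (q - p) ^ 2 / 2 <= RInt f p q
     <= f q * (q - p) - l * (q - p) ^ 2 / 2).
Proof.
  intros Hpq H.
  assert (Hi := lipschitzian_ex_RInt _ _ _ _ _ Hpq H).
  assert (Hp : forall t, p <= t <= q ->
                 f p + l * (t - p) <= f t <= f p + L * (t - p))
    by (intros t Ht; specialize (H p t); lra).
  assert (Hq : forall t, p <= t <= q ->
                 f q + L * (t - q) <= f t <= f q + l * (t - q))
    by (intros t Ht; specialize (H t q); lra).
  assert (H1 := RInt_ge_affine (f p) l p p q f Hpq Hi (fun t Ht => proj1 (Hp t Ht))).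
  assert (H2 := RInt_le_affine (f p) L p p q f Hpq Hi (fun t Ht => proj2 (Hp t Ht))).
  assert (H3 := RInt_ge_affine (f q) L q p q f Hpq Hi (fun t Ht => proj1 (Hq t Ht))).
  assert (H4 := RInt_le_affine (f q) l q p q f Hpq Hi (fun t Ht => proj2 (Hq t Ht))).
  split; split; lra.
Qed.

Lemma lipschitzian_RInt_Chasles (l L a b p q r : R) (f : R -> R) :
  lipschitzian l L a b f -> a <= p <= b -> a <= q <= b -> a <= r <= b ->
  RInt f p r = RInt f p q + RInt f q r.
Proof.
  intros H Hp Hq Hr.
  assert (Hi : forall u v, a <= u <= b -> a <= v <= b -> ex_RInt f u v).
  { intros u v Hu Hv; destruct (Rle_dec u v).
    - apply (lipschitzian_ex_RInt l L); [lra|].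
      apply lipschitzian_restrict with a b; lra || assumption.
    - apply ex_RInt_swap, (lipschitzian_ex_RInt l L); [lra|].
      apply lipschitzian_restrict with a b; lra || assumption. }
  symmetry; apply (RInt_Chasles (V := R_CompleteNormedModule)); auto.
Qed.

(** For [v < s] the slopes exchange roles, and so do the bounds when the integral changes sign.
    Hence one centre and one radius serve both orientations. *)
Lemma lipschitzian_RInt_oriented (l L a b s v : R) (f : R -> R) :
  lipschitzian l L a b f -> a <= s <= b -> a <= v <= b ->
  Rabs (RInt f s v - (f s * (v - s) + (L + l) / 2 * (v - s) ^ 2 / 2))
    <= (L - l) / 2 * (v - s) ^ 2 / 2.
Proof.
  intros H Hs Hv; apply Rabs_le.
  destruct (Rle_dec s v) as [Hsv|Hsv].
  - destruct (lipschitzian_RInt_bounds l L s v f) as [H1 H2];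
      [lra | apply lipschitzian_restrict with a b; lra || assumption |].
    split; lra.
  - assert (Hsw := opp_RInt_swap f v s).
    destruct (lipschitzian_RInt_bounds l L v s f) as [H1 H2];
      [lra | apply lipschitzian_restrict with a b; lra || assumption |].
    rewrite <- Hsw by (apply (lipschitzian_ex_RInt l L); [lra|];
      apply lipschitzian_restrict with a b; lra || assumption).
    unfold opp; simpl; split; lra.
Qed.

(** * The error on one subinterval *)

(** The correction term makes the error vanish on affine functions of slope [c]. *)
Definition quadrature_error (c p q s : R) (f : R -> R) : R :=
  RInt f p q
  - (1 / 2 * (f s * (q - p)) + 1 / 2 * ((f p + f q) / 2 * (q - p))
     - c / 2 * ((s - (p + q) / 2) * (q - p))).

(* The outer quarters of [p,q] are compared with the values at the endpoints
   and the middle half with the value at [s]. Integrating from [s] in both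
   directions makes this uniform, wherever [s] lies. *)
Lemma quadrature_error_mean (l L p q s : R) (f : R -> R) :
  lipschitzian l L p q f -> p <= s <= q ->
  Rabs (quadrature_error ((L + l) / 2) p q s f) <=
    1 / 2 * ((q - p) ^ 2 / 8 + (s - (p + q) / 2) ^ 2) * (L - l).
Proof.
  intros H Hs.
  (* Cutting at the quarter points gives [f p], [f s], [f q] the weights 1/4, 1/2, 1/4 of the
     rule. *)
  set (c1 := (3 * p + q) / 4). set (c2 := (p + 3 * q) / 4).
  assert (Hc1 : p <= c1 <= q) by (unfold c1; lra).
  assert (Hc2 : p <= c2 <= q) by (unfold c2; lra).
  assert (Hp : p <= p <= q) by lra. assert (Hq : p <= q <= q) by lra.
  assert (E1 := lipschitzian_RInt_oriented l L p q p c1 f H Hp Hc1).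
  assert (E2 := lipschitzian_RInt_oriented l L p q s c1 f H Hs Hc1).
  assert (E3 := lipschitzian_RInt_oriented l L p q s c2 f H Hs Hc2).
  assert (E4 := lipschitzian_RInt_oriented l L p q q c2 f H Hq Hc2).
  assert (C1 := lipschitzian_RInt_Chasles l L p q p c1 s f H Hp Hc1 Hs).
  assert (C2 := lipschitzian_RInt_Chasles l L p q p s q f H Hp Hs Hq).
  assert (C3 := lipschitzian_RInt_Chasles l L p q s c2 q f H Hs Hc2 Hq).
  (* Round trips have integral zero, which reverses the integrals from [c1] to [s] and from [c2] to
     [q] to match [E2] and [E4]. *)
  assert (C4 := lipschitzian_RInt_Chasles l L p q c1 s c1 f H Hc1 Hs Hc1).
  assert (C5 := lipschitzian_RInt_Chasles l L p q c2 q c2 f H Hc2 Hq Hc2).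
  rewrite !RInt_point in C4, C5; change (zero : R) with 0 in C4, C5.
  (* With [m] the midpoint, [(s - c1)^2 + (s - c2)^2 = 2 * (s - m)^2 + (q - p)^2 / 8]. The outer
     quarters add another [(q - p)^2 / 8], and the radii sum exactly to the bound. *)
  apply Rabs_le_between in E1, E2, E3, E4.
  unfold quadrature_error; apply Rabs_le.
  unfold c1, c2 in *; split; lra.
Qed.

(** The function [g t = f t - l * t] is nondecreasing and has the same error, now without correction
    term. Let [u], [v] be its increments over [[p,s]] and [[s,q]], and put [h = q - p],
    [d = s - (p + q) / 2]. Bounding [g] on each piece by its end values puts the error between
    [- u * (h / 4 + d) - v * h / 4] and [u * h / 4 + v * (h / 4 - d)]. All coefficients are at most
    [h / 4 + Rabs d] in absolute value. *)
Lemma quadrature_error_lower (l L p q s : R) (f : R -> R) :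
  lipschitzian l L p q f -> p <= s <= q ->
  Rabs (quadrature_error l p q s f) <=
    ((q - p) / 4 + Rabs (s - (p + q) / 2)) * (f q - f p - l * (q - p)).
Proof.
  intros H Hs.
  destruct (lipschitzian_RInt_bounds l L p s f) as [[H1 _] [_ H2]];
    [lra | apply lipschitzian_restrict with p q; lra || assumption |].
  destruct (lipschitzian_RInt_bounds l L s q f) as [[H3 _] [_ H4]];
    [lra | apply lipschitzian_restrict with p q; lra || assumption |].
  assert (C : RInt f p q = RInt f p s + RInt f s q)
    by (apply (lipschitzian_RInt_Chasles l L p q); lra || assumption).
  assert (Hps : 0 <= f s - f p - l * (s - p)) by (specialize (H p s); lra).
  assert (Hsq : 0 <= f q - f s - l * (q - s)) by (specialize (H s q); lra).
  assert (P1 : 0 <= (q - p) * (f s - f p - l * (s - p)))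
    by (apply Rmult_le_pos; lra).
  assert (P2 : 0 <= (q - p) * (f q - f s - l * (q - s)))
    by (apply Rmult_le_pos; lra).
  assert (P3 := Rmult_le_pos _ _ (Rabs_pos (s - (p + q) / 2)) Hps).
  assert (P4 := Rmult_le_pos _ _ (Rabs_pos (s - (p + q) / 2)) Hsq).
  unfold quadrature_error; apply Rabs_le.
  unfold Rabs in *; destruct (Rcase_abs (s - (p + q) / 2)); split; lra.
Qed.

Lemma quadrature_error_upper (l L p q s : R) (f : R -> R) :
  lipschitzian l L p q f -> p <= s <= q ->
  Rabs (quadrature_error L p q s f) <=
    ((q - p) / 4 + Rabs (s - (p + q) / 2)) * (L * (q - p) - (f q - f p)).
Proof.
  intros H Hs.
  assert (Hi : ex_RInt f p q)
    by (apply (lipschitzian_ex_RInt l L); lra || assumption).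
  assert (E := quadrature_error_lower _ _ _ _ _ _ (lipschitzian_opp _ _ _ _ _ H) Hs).
  assert (Ho := RInt_opp f p q Hi).
  change (RInt (fun t => - f t) p q = - RInt f p q) in Ho.
  rewrite <- Rabs_Ropp.
  replace (- quadrature_error L p q s f)
    with (quadrature_error (- L) p q s (fun t => - f t))
    by (unfold quadrature_error; rewrite Ho; field).
  lra.
Qed.

(** * Summation over the subdivision *)

Lemma subdivides_le (a b : R) (n : nat) (x : nat -> R) :
  subdivides a b n x ->
  forall i j : nat, (i <= j)%nat -> (j <= n)%nat -> x i <= x j.
Proof.
  intros [_ [_ H]] i j Hij; induction Hij as [|j Hij IH]; intros Hj.
  - lra.
  - specialize (H j Hj); specialize (IH ltac:(lia)); lra.
Qed.

Lemma subdivides_range (a b : R) (n : nat) (x : nat -> R) (i : nat) :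
  subdivides a b n x -> (i <= n)%nat -> a <= x i <= b.
Proof.
  intros H Hi; assert (Hle := subdivides_le _ _ _ _ H).
  destruct H as [<- [<- _]]; split; apply Hle; lia.
Qed.

Lemma R_l_sum (l L c a b : R) (n : nat) (x xi : nat -> R) (f : R -> R) :
  lipschitzian l L a b f -> subdivides a b n x ->
  R_l c a b n x xi f =
    sum_lt n (fun i => quadrature_error c (x i) (x (S i)) (xi i) f).
Proof.
  intros H Hx.
  (* The induction is on prefixes ending at [x k], while [a], [b] and [n] stay fixed so that every
     point remains in [[a,b]]. *)
  assert (Hk : forall k, (k <= n)%nat ->
    RInt f (x 0%nat) (x k) - A_l c k x xi f =
      sum_lt k (fun i => quadrature_error c (x i) (x (S i)) (xi i) f)).
  { induction k as [|k IH]; intros Hk.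
    - rewrite RInt_point; unfold A_l; simpl; change (zero : R) with 0; ring.
    - rewrite sum_lt_S, <- IH by lia.
      rewrite (lipschitzian_RInt_Chasles l L a b _ (x k) _ f H)
        by (apply subdivides_range with n; assumption || lia).
      unfold A_l, quadrature_error, midpoint, step; rewrite !sum_lt_S; ring. }
  specialize (Hk n (le_n n)); destruct Hx as [H0 [Hn _]].
  unfold R_l; rewrite <- Hk, H0, Hn; reflexivity.
Qed.

Theorem theorem9 (a b l L : R) (f : R -> R) (n : nat) (x xi : nat -> R)
  (hab : a < b) (hlL : l < L)
  (hf : lipschitzian l L a b f)
  (hx : subdivides a b n x)
  (hxi : forall i : nat, (i < n)%nat -> x i <= xi i <= x (S i)) :
  (RInt f a b = A_Ll l L n x xi f + R_Ll l L a b n x xi f /\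
   Rabs (R_Ll l L a b n x xi f) <=
     sum_lt n (fun i =>
       1 / 2 * ((step x i) ^ 2 / 8 + (xi i - midpoint x i) ^ 2) * (L - l))) /\
  (RInt f a b = A_l l n x xi f + R_l l a b n x xi f /\
   Rabs (R_l l a b n x xi f) <=
     sum_lt n (fun i =>
       step x i * (step x i / 4 + Rabs (xi i - midpoint x i))
       * (slope f x i - l))) /\
  (RInt f a b = A_L L n x xi f + R_L L a b n x xi f /\
   Rabs (R_L L a b n x xi f) <=
     sum_lt n (fun i =>
       step x i * (step x i / 4 + Rabs (xi i - midpoint x i))
       * (L - slope f x i))).
Proof.
  assert (Hloc : forall i, (i < n)%nat ->
            lipschitzian l L (x i) (x (S i)) f /\ 0 < step x i).
  { intros i Hi; split.
    - apply lipschitzian_restrict with a b; [assumption | |].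
      + apply (subdivides_range a b n x i hx); lia.
      + apply (subdivides_range a b n x (S i) hx); lia.
    - unfold step; destruct hx as [_ [_ Hlt]]; specialize (Hlt i Hi); lra. }
  split; [|split]; (split; [symmetry; apply Rplus_minus|]).
  - replace (R_Ll l L a b n x xi f) with (R_l ((L + l) / 2) a b n x xi f)
      by (unfold R_Ll, R_l, A_Ll, A_l; field).
    rewrite (R_l_sum l L) by assumption.
    apply Rabs_sum_lt_le; intros i Hi.
    apply quadrature_error_mean; [apply Hloc | apply hxi]; assumption.
  - rewrite (R_l_sum l L) by assumption.
    apply Rabs_sum_lt_le; intros i Hi; destruct (Hloc i Hi) as [Hf Hs].
    apply Rle_trans with (1 := quadrature_error_lower l L _ _ _ f Hf (hxi i Hi)).
    (* The two bounds are equal: the factor [step x i], positive by [Hs], cancels the denominator of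
       [slope]. *)
    unfold slope, midpoint, step in *; right; field; lra.
  - change (R_L L a b n x xi f) with (R_l L a b n x xi f).
    rewrite (R_l_sum l L) by assumption.
    apply Rabs_sum_lt_le; intros i Hi; destruct (Hloc i Hi) as [Hf Hs].
    apply Rle_trans with (1 := quadrature_error_upper l L _ _ _ f Hf (hxi i Hi)).
    unfold slope, midpoint, step in *; right; field; lra.
Qed.
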